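(* Let $\mathcal{A}\in\mathbb{C}^{I_1\times\cdots\times I_M\times I_1\times\cdots\times I_M}$ be a Hermitian tensor with eigenvalues $\lambda_1\ge\lambda_2\ge\cdots\ge\lambda_{\mathbb{I}_M}$ and corresponding orthonormal eigen-tensors $\mathcal{U}_1,\mathcal{U}_2,\dots,\mathcal{U}_{\mathbb{I}_M}$, where $\mathbb{I}_M=\prod_{i=1}^M I_i$. Spaces $S_k$ and $T_k$ are obtained by spanning via eigen-tensors $\mathcal{U}_j$ for $j\in\{1,\dots,\mathbb{I}_M\}$, with dimensions $k$ and $\mathbb{I}_M-k+1$, respectively. Then $$\lambda_k=\max_{\substack{S_k\subseteq\mathbb{C}^{I_1\times\cdots\times I_M}\\ \dim(S_k)=k}}\ \min_{\mathcal{X}\in S_k}\frac{\mathcal{X}^{\mathrm{T}}\star_M\mathcal{A}\star_M\mathcal{X}}{\mathcal{X}^{\mathrm{T}}\star_M\mathcal{X}}=\min_{\substack{T_k\subseteq\mathbb{C}^{I_1\times\cdots\times I_M}\\ \dim(T_k)=\mathbb{I}_M-k+1}}\ \max_{\mathcal{X}\in T_k}\frac{\mathcal{X}^{\mathrm{T}}\star_M\mathcal{A}\star_M\mathcal{X}}{\mathcal{X}^{\mathrm{T}}\star_M\mathcal{X}}.$$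
   Context: $I_1,\dots,I_M$ are positive integers, and $\mathbb{C}^{I_1\times\cdots\times I_M}$ is the set of order-$M$ complex tensors of size $I_1\times\cdots\times I_M$. The Einstein product of $\mathcal{X}=(a_{i_1,\dots,i_M,j_1,\dots,j_N})$ and $\mathcal{Y}=(b_{j_1,\dots,j_N,k_1,\dots,k_L})$ is $(\mathcal{X}\star_N\mathcal{Y})_{i_1,\dots,i_M,k_1,\dots,k_L}=\sum_{j_1,\dots,j_N}a_{i_1,\dots,i_M,j_1,\dots,j_N}\,b_{j_1,\dots,j_N,k_1,\dots,k_L}$ (the tensor-vector case $L=0$ is included). The conjugate transpose $\mathcal{X}^H$ of $\mathcal{X}=(a_{i_1,\dots,i_M,j_1,\dots,j_N})$ has entries $(\mathcal{X}^H)_{j_1,\dots,j_N,i_1,\dots,i_M}=\overline{a_{i_1,\dots,i_M,j_1,\dots,j_N}}$, and a tensor $\mathcal{A}$ is Hermitian if $\mathcal{A}^H=\mathcal{A}$. The superscript $\mathrm{T}$ denotes the transpose. A scalar $\lambda$ is an eigenvalue of $\mathcal{A}\in\mathbb{C}^{I_1\times\cdots\times I_M\times I_1\times\cdots\times I_M}$ with corresponding eigen-tensor $\mathcal{X}\in\mathbb{C}^{I_1\times\cdots\times I_M}$ if $\mathcal{A}\star_M\mathcal{X}=\lambda\mathcal{X}$.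
   Formalization: The quotient is taken with the conjugate transpose X^H in place of the printed X^T (and over nonzero X), since with the plain transpose the claim fails over the complex numbers, e.g. for A = [[0,-i],[i,0]], where X^T A X = 0 for all X. *)

(* Defs.v *)
From mathcomp Require Import all_boot all_order all_algebra.
From mathcomp Require Import complex.
From mathcomp Require Import reals.

Set Implicit Arguments.
Unset Strict Implicit.
Unset Printing Implicit Defensive.

Import Order.TTheory GRing.Theory Num.Theory.
Local Open Scope ring_scope.
Local Open Scope complex_scope.

(* Multi-indices (i_1, ..., i_M) with i_m < I_m, for I = [:: I_1; ...; I_M];
   the empty multi-index is tt. *)
Fixpoint midx (I : seq nat) : finType :=
  if I is d :: I' then ('I_d * midx I')%type else unit.

(* Tensors in C^(I_1 x ... x I_M x J_1 x ... x J_N), C = R[i], whose indices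
   are grouped in two blocks.  An order-M tensor, i.e. an element of
   C^(I_1 x ... x I_M), has an empty second block (tensor1), and a scalar has
   two empty blocks.  The regular module R[i]^o (convertible to R[i]) as
   codomain makes these types finite-dimensional R[i]-vector spaces. *)
Definition tensor (R : realType) (I J : seq nat) :=
  {ffun midx I * midx J -> R[i]^o}.

Definition tensor1 (R : realType) (I : seq nat) := tensor R I [::].

Definition scalar_of (R : realType) (x : tensor R [::] [::]) : R[i] :=
  x (tt, tt).

Definition einstein (R : realType) (I J K : seq nat)
    (X : tensor R I J) (Y : tensor R J K) : tensor R I K :=
  [ffun p => \sum_(j : midx J) (X (p.1, j) : R[i]) * (Y (j, p.2) : R[i])].

Notation "X \star Y" := (einstein X Y)
  (at level 40, left associativity) : ring_scope.

Definition conj_transpose (R : realType) (I J : seq nat)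
    (X : tensor R I J) : tensor R J I :=
  [ffun p => (X (p.2, p.1) : R[i])^*%R].

Definition hermitian_tensor (R : realType) (I : seq nat) (A : tensor R I I) :=
  conj_transpose A = A.

Definition is_eigenpair (R : realType) (I : seq nat) (A : tensor R I I)
    (l : R[i]) (X : tensor1 R I) :=
  A \star X = l *: X.

Definition inner (R : realType) (I : seq nat) (X Y : tensor1 R I) : R[i] :=
  scalar_of (conj_transpose X \star Y).

Definition orthonormal_family (R : realType) (I : seq nat) (n : nat)
    (U : 'I_n -> tensor1 R I) :=
  forall i j, inner (U i) (U j) = (i == j)%:R.

(* Over the complex numbers, the transpose in the Rayleigh quotient has to be
   the conjugate one: X^T * X may vanish for X != 0. *)
Definition rayleigh (R : realType) (I : seq nat) (A : tensor R I I)
    (X : tensor1 R I) : R[i] :=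
  scalar_of (conj_transpose X \star A \star X)
    / scalar_of (conj_transpose X \star X).

(* The order of R[i] is partial: x <= y iff y - x is a nonnegative real. *)
Definition is_min_over (T : Type) (R : realType) (P : T -> Prop)
    (f : T -> R[i]) (m : R[i]) :=
  (exists2 x, P x & f x = m) /\ (forall x, P x -> m <= f x).

Definition is_max_over (T : Type) (R : realType) (P : T -> Prop)
    (f : T -> R[i]) (m : R[i]) :=
  (exists2 x, P x & f x = m) /\ (forall x, P x -> f x <= m).

Definition nonzero_in (K : fieldType) (V : vectType K) (S : {vspace V})
    (X : V) : Prop :=
  X \in S /\ X != 0.

(* The inner extrema are attained on every admissible space, and l is the
   attained outer extremum of these. *)
Definition is_max_min (R : realType) (V : vectType R[i])
    (P : {vspace V} -> Prop) (f : V -> R[i]) (l : R[i]) :=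
  exists m : {vspace V} -> R[i],
    (forall S, P S -> is_min_over (nonzero_in S) f (m S)) /\
    is_max_over P m l.

Definition is_min_max (R : realType) (V : vectType R[i])
    (P : {vspace V} -> Prop) (f : V -> R[i]) (l : R[i]) :=
  exists m : {vspace V} -> R[i],
    (forall S, P S -> is_max_over (nonzero_in S) f (m S)) /\
    is_min_over P m l.

Definition spanned_by (K : fieldType) (V : vectType K) (n : nat)
    (U : 'I_n -> V) (S : {vspace V}) : Prop :=
  exists J : {set 'I_n}, S = <<[seq U j | j in J]>>%VS.

(* Main.v *)
Require Import Defs.
From HB Require Import structures.
From mathcomp Require Import all_boot all_order all_algebra.
From mathcomp Require Import complex.
From mathcomp Require Import reals.
From mathcomp Require Import boolp.

(** The Courant-Fischer theorem for a Hermitian tensor [A] acting on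
    [tensor1 R I], a complex vector space of dimension [n], the product of the
    [I_m].  The Rayleigh quotient is [h X X / d X X], where [d] is the inner
    product of tensors and [h X Y = scalar_of (Y^H * A * X)] is a Hermitian
    sesquilinear form; up to the max-min principle, the proof is about two
    such forms on an arbitrary finite-dimensional space.

    If [W] is orthonormal for [d] and diagonalizes [h] with values [mu], then
    the quotient at [\sum_j c_j W_j] is the mean of the [mu_j] with weights
    [|c_j|^2], hence lies between the least and the greatest [mu_j] involved
    ([form_quotient_bounds]).  This is used twice.

    First, every subspace [S] has such a basis [W] ([principal_axes]: the
    spectral theorem for the compression of [h] to [S]), so that the minimum
    of the quotient over the nonzero vectors of [S] is attained, at an axis of
    least [mu_j] ([form_quotient_min_attained]).  This replaces the usual
    appeal to the compactness of the unit sphere.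

    Second, for the eigenbasis [U] itself: on the span of [U_0, ..., U_k] the
    quotient is at least [lam k]; and every [S] of dimension [k + 1] meets the
    span of [U_k, ..., U_(n-1)], where the quotient is at most [lam k], in a
    nonzero vector, because the two dimensions add up to [n + 1].  This gives
    the max-min formula ([max_min_principle]).  It is proved for any class of
    subspaces of dimension [k + 1] that contains the span of [U_0, ..., U_k],
    which covers both the class of all these subspaces and the class of those
    spanned by eigen-tensors.

    The min-max formula is the max-min formula for [- A], whose eigenvalues
    are the [- lam j] in reverse order ([tensor_min_max]). *)

Set Implicit Arguments.
Unset Strict Implicit.
Unset Printing Implicit Defensive.

Import Order.TTheory GRing.Theory Num.Theory.
Import Num.Def.
Local Open Scope ring_scope.
Local Open Scope complex_scope.

(** * Simultaneous diagonalization of two Hermitian forms *)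

Section Forms.
Variables (C : numClosedFieldType) (V : vectType C).
Implicit Types (h : {hermitian_sym V for conjC}) (d : {dot V for conjC}).

Definition gram_mx h (n : nat) (b : 'I_n -> V) : 'M[C]_n :=
  \matrix_(i, j) h (b i) (b j).

Definition recombine (n : nat) (P : 'M[C]_n) (b : 'I_n -> V) (i : 'I_n) : V :=
  \sum_j P i j *: b j.

Lemma gram_mx_hermitian h n (b : 'I_n -> V) : gram_mx h b \is hermsymmx.
Proof.
apply/is_hermitianmxP/matrixP=> i j; rewrite !mxE expr0 mul1r.
by rewrite (hermC h) expr0 mul1r.
Qed.

Lemma gram_recombine h n (P : 'M[C]_n) (b : 'I_n -> V) :
  gram_mx h (recombine P b) = P *m gram_mx h b *m (map_mx conjC P^T).
Proof.
apply/matrixP=> i j; rewrite !mxE linear_sumr; apply: eq_bigr => l _ /=.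
rewrite linearZr_LR /= !mxE mulrC; congr (_ * _).
rewrite linear_sumlz; apply: eq_bigr => m _.
by rewrite linearZl_LR mxE.
Qed.

(** The spectral theorem for the Gram matrix of [h] on [b], read as a change
    of family.  As the change is unitary, it preserves orthonormality for any
    other form, which lets two forms be diagonalized one after the other. *)
Lemma gram_diagonalizable h n (b : 'I_n -> V) :
  exists2 P : 'M[C]_n, P \is unitarymx &
  exists2 mu : 'I_n -> C, (forall i, mu i \is Num.real) &
    gram_mx h (recombine P b) = diag_mx (\row_i mu i).
Proof.
have H_herm := gram_mx_hermitian h b.
set H := gram_mx h b in H_herm *.
have P_unit := spectral_unitarymx H.
exists (spectralmx H) => //; exists (spectral_diag H 0).
  by move=> i; have /mxOverP := hermitian_spectral_diag_real H_herm; apply.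
rewrite gram_recombine -/H.
have /orthomx_spectralP H_eq := hermitian_normalmx H_herm.
rewrite [X in _ *m X *m _]H_eq.
rewrite invmx_unitary // !mulmxA (unitarymxP _) // mul1mx mulmxtVK //.
by congr diag_mx; apply/rowP=> j; rewrite mxE.
Qed.

Definition orthonormal_for d n (W : 'I_n -> V) :=
  forall i j, d (W i) (W j) = (i == j)%:R.

Lemma orthonormal_forE d n (W : 'I_n -> V) :
  orthonormal_for d W <-> gram_mx d W = 1%:M.
Proof.
split=> [oW | /matrixP oW i j]; last by have := oW i j; rewrite !mxE.
by apply/matrixP=> i j; rewrite !mxE; exact: oW.
Qed.

Lemma recombine_mem n (P : 'M[C]_n) (b : 'I_n -> V) (S : {vspace V}) i :
  (forall j, b j \in S) -> recombine P b i \in S.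
Proof. by move=> bS; apply: memv_suml => j _; apply: memvZ. Qed.

(** Diagonalizing [d] on any basis of [S] gives an orthogonal basis, whose
    squared norms [mu i] are positive; it remains to normalize it. *)
Lemma orthonormal_basis_exists d (S : {vspace V}) :
  exists2 W : 'I_(\dim S) -> V, (forall i, W i \in S) & orthonormal_for d W.
Proof.
pose b (i : 'I_(\dim S)) := (vbasis S)`_i.
have bS i : b i \in S by apply/vbasis_mem/mem_nth; rewrite size_tuple.
have [P P_unit [mu mu_real Gmu]] := gram_diagonalizable d b.
set b' := recombine P b in Gmu.
(* A row of the unitary [P] has norm 1, so it is not zero, and [b] is free. *)
have b'_neq0 i : b' i != 0.
  have /freeP b_free := basis_free (vbasisP S).
  apply/eqP=> /b_free Pi0.
  have /unitarymxP/matrixP/(_ i i) := P_unit.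
  rewrite !mxE eqxx big1 => [/esym/eqP|j _]; first by rewrite oner_eq0.
  by rewrite Pi0 mul0r.
have Gb' i j : d (b' i) (b' j) = mu i *+ (i == j).
  by have /matrixP/(_ i j) := Gmu; rewrite !mxE.
have mu_gt0 i : 0 < mu i.
  by have := Gb' i i; rewrite eqxx mulr1n => <-; rewrite dnorm_gt0.
exists (fun i => (sqrtC (mu i))^-1 *: b' i) => [i | i j].
  exact/memvZ/recombine_mem.
rewrite linearZl_LR linearZr_LR /= Gb'.
case: eqP => [->|_]; last by rewrite !mulr0.
set s := sqrtC (mu j).
have s_gt0 : 0 < s by rewrite sqrtC_gt0.
rewrite mulr1n [X in _ * (X * _)]geC0_conj ?invr_ge0 ?ltW //.
by rewrite -[mu j]sqrtCK -/s expr2 mulKf ?mulVf ?gt_eqF.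
Qed.

Definition diagonal_for h n (W : 'I_n -> V) (mu : 'I_n -> C) :=
  forall i j, h (W i) (W j) = mu i *+ (i == j).

(** The principal axis theorem for the restriction of [h] to [S].  An operator
    representing [h] need not preserve [S], but the form restricts to any [S];
    its diagonalization on an orthonormal basis of [S] is unitary, so the basis
    remains orthonormal. *)
Lemma principal_axes h d (S : {vspace V}) :
  exists2 W : 'I_(\dim S) -> V, (forall i, W i \in S) /\ orthonormal_for d W &
  exists2 mu : 'I_(\dim S) -> C, (forall i, mu i \is Num.real) &
    diagonal_for h W mu.
Proof.
have [b bS /orthonormal_forE ob] := orthonormal_basis_exists d S.
have [P P_unit [mu mu_real Gmu]] := gram_diagonalizable h b.
exists (recombine P b); last exists mu => // [i j].
  split=> [i|]; first exact: recombine_mem.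
  by apply/orthonormal_forE; rewrite gram_recombine ob mulmx1; apply/unitarymxP.
by have /matrixP/(_ i j) := Gmu; rewrite !mxE => ->; case: eqP => // ->.
Qed.

(** * Quotients of forms on coordinate subspaces *)

Definition subspan n (W : 'I_n -> V) (J : {set 'I_n}) : {vspace V} :=
  <<[seq W j | j in J]>>%VS.

Lemma subspanP n (W : 'I_n -> V) J X :
  X \in subspan W J -> exists c : 'I_n -> C, X = \sum_(j in J) c j *: W j.
Proof.
rewrite /subspan span_def big_image /= => /memv_sumP[vs vsW ->].
have /choice[c cP] j : exists c, j \in J -> vs j = c *: W j.
  case: (boolP (j \in J)) => [Jj|]; last by exists 0.
  by have /vlineP[c ->] := vsW j Jj; exists c.
by exists c; apply: eq_bigr => j /cP.
Qed.

Lemma dim_subspan d n (W : 'I_n -> V) J :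
  orthonormal_for d W -> \dim (subspan W J) = #|J|.
Proof.
move=> oW; have W_inj : injective W.
  move=> i j Wij; have := oW i i; rewrite {2}Wij oW eqxx.
  by case: eqP => // _ /esym/eqP; rewrite oner_eq0.
have oJ : orthonormal d [seq W j | j in J].
  apply/orthonormalP; rewrite (map_inj_uniq W_inj) enum_uniq; split=> //.
  by move=> _ _ /mapP[i _ ->] /mapP[j _ ->]; rewrite oW (inj_eq W_inj).
by have := orthonormal_free oJ; rewrite /free size_image => /eqP.
Qed.

Lemma subspan_setT d n (W : 'I_n -> V) (S : {vspace V}) :
  orthonormal_for d W -> (forall i, W i \in S) -> \dim S = n ->
  subspan W [set: 'I_n] = S.
Proof.
move=> oW WS dimS; apply/eqP; rewrite eqEdim (dim_subspan _ oW) cardsT card_ord.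
by rewrite dimS leqnn andbT; apply/span_subvP => _ /mapP[i _ ->].
Qed.

Lemma diagonal_form_sum h n (W : 'I_n -> V) mu (J : {set 'I_n}) c :
  diagonal_for h W mu ->
  let X := \sum_(j in J) c j *: W j in
  h X X = \sum_(j in J) mu j * `|c j| ^+ 2.
Proof.
move=> dW /=; rewrite linear_sumlz; apply: eq_bigr => i Ji.
rewrite linearZl_LR linear_sumr (bigD1 i) //= big1 => [|j /andP[_ /negPf ji]].
  by rewrite addr0 linearZr_LR /= dW eqxx mulr1n normCK mulrA mulrC.
by rewrite linearZr_LR /= dW eq_sym ji mulr0.
Qed.

Definition form_quotient h d X := h X X / d X X.

Lemma orthonormal_diagonal d n (W : 'I_n -> V) :
  orthonormal_for d W -> diagonal_for d W (fun=> 1).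
Proof. by move=> oW i j; rewrite [LHS]oW. Qed.

Lemma form_quotient_axis h d n (W : 'I_n -> V) mu i :
  orthonormal_for d W -> diagonal_for h W mu -> form_quotient h d (W i) = mu i.
Proof. by move=> oW dW; rewrite /form_quotient oW dW eqxx divr1. Qed.

Lemma axis_neq0 d n (W : 'I_n -> V) i : orthonormal_for d W -> W i != 0.
Proof. by move=> oW; rewrite -(dnorm_eq0 d) oW eqxx oner_eq0. Qed.

(** The quotient is a mean of the [mu j] with weights [|c j|^2].  As the
    order of [C] is only partial, the [mu j] are compared with a bound [a]
    instead of their own extrema. *)
Lemma form_quotient_bounds h d n (W : 'I_n -> V) mu J X :
  orthonormal_for d W -> diagonal_for h W mu ->
  X \in subspan W J -> X != 0 ->
  (forall a, (forall j, j \in J -> a <= mu j) -> a <= form_quotient h d X) /\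
  (forall a, (forall j, j \in J -> mu j <= a) -> form_quotient h d X <= a).
Proof.
move=> oW dW /subspanP[c Xc] X_neq0.
have dX : 0 < d X X by rewrite dnorm_gt0.
have hE := diagonal_form_sum J c dW.
have dE := diagonal_form_sum J c (orthonormal_diagonal oW).
rewrite /form_quotient; split=> a le_a.
  rewrite ler_pdivlMr // Xc hE dE mulr_sumr; apply: ler_sum => j Jj.
  by rewrite mul1r ler_wpM2r ?exprn_ge0 // le_a.
rewrite ler_pdivrMr // Xc hE dE mulr_sumr; apply: ler_sum => j Jj.
by rewrite mul1r ler_wpM2r ?exprn_ge0 // le_a.
Qed.

End Forms.

(** * The max-min principle *)

Section CourantFischer.
Variables (R : realType) (V : vectType R[i]).
Implicit Types (h : {hermitian_sym V for conjC}) (d : {dot V for conjC}).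

(** The minimum is the least [mu j] of a system of principal axes of [S]; it
    exists in the partially ordered field [R[i]] because the [mu j] are real. *)
Lemma form_quotient_min_attained h d (S : {vspace V}) :
  (0 < \dim S)%N -> exists m, is_min_over (nonzero_in S) (form_quotient h d) m.
Proof.
move=> S_gt0; have [W [WS oW] [mu mu_real dW]] := principal_axes h d S.
have mu_cmp : {in xpredT &, forall i j, mu i >=< mu j}.
  by move=> i j _ _; apply: real_comparable.
pose i0 := Ordinal S_gt0.
have [i _ i_min] := @comparable_arg_minP _ _ _ i0 xpredT mu isT mu_cmp.
exists (mu i); split; first exists (W i).
- by split; [exact: WS | exact: axis_neq0 oW].
- exact: form_quotient_axis oW dW.
move=> X [XS X_neq0].
have XW : X \in subspan W setT by rewrite (subspan_setT oW WS).
by apply: (form_quotient_bounds oW dW XW X_neq0).1 => j _; apply: i_min.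
Qed.

Lemma card_ord_lt (n k : nat) :
  (k <= n)%N -> #|[set j : 'I_n | (j < k)%N]| = k.
Proof.
move=> k_le_n; rewrite -sum1_card (eq_bigl (fun j : 'I_n => (j < k)%N)).
  by rewrite -(big_ord_widen _ (fun=> 1%N)) // sum1_card card_ord.
by move=> j; rewrite inE.
Qed.

Lemma card_ord_ge (n k : nat) :
  (k <= n)%N -> #|[set j : 'I_n | (k <= j)%N]| = (n - k)%N.
Proof.
move=> k_le_n; rewrite cardsCs card_ord -[in RHS](card_ord_lt k_le_n).
by congr (_ - _)%N; apply: eq_card => j; rewrite !inE -ltnNge.
Qed.

(** The dimension count [dim (S :&: T) = dim S + dim T - dim (S + T)], where
    [dim (S + T)] is at most [dim V]. *)
Lemma subspan_meets d n (W : 'I_n -> V) (J : {set 'I_n}) (S : {vspace V}) :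
  orthonormal_for d W -> (\dim {:V} < \dim S + #|J|)%N ->
  exists2 X, X \in S /\ X != 0 & X \in subspan W J.
Proof.
move=> oW dim_gt.
have cap_neq0 : (S :&: subspan W J)%VS != 0%VS.
  rewrite -dimv_eq0 -lt0n -(ltn_add2l (\dim (S + subspan W J))) addn0.
  rewrite dimv_sum_cap (dim_subspan _ oW); apply: leq_ltn_trans dim_gt.
  exact/dimvS/subvf.
exists (vpick (S :&: subspan W J)); last first.
  by have := memv_pick (S :&: subspan W J); rewrite memv_cap => /andP[].
rewrite vpick0; split=> //.
by have := memv_pick (S :&: subspan W J); rewrite memv_cap => /andP[].
Qed.

(** The upper bound holds for every competing [S] by the dimension count, and
    the span of the first [k + 1] axes reaches it.  Hence the class [P] of
    competitors may be any one that contains this span. *)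
Lemma max_min_principle h d n (W : 'I_n -> V) (lam : 'I_n -> R[i]) (k : 'I_n)
    (P : {vspace V} -> Prop) :
  \dim {:V} = n -> orthonormal_for d W -> diagonal_for h W lam ->
  (forall i j : 'I_n, (i <= j)%N -> lam j <= lam i) ->
  (forall S, P S -> \dim S = k.+1) ->
  P (subspan W [set j : 'I_n | (j <= k)%N]) ->
  is_max_min P (form_quotient h d) (lam k).
Proof.
move=> dimV oW dW lam_decr dimP P_top.
(* Only subspaces other than 0 have a minimum: the value chosen at 0 is
   arbitrary. *)
have /choice[m mP] S : exists a,
    (0 < \dim S)%N -> is_min_over (nonzero_in S) (form_quotient h d) a.
  have [/(form_quotient_min_attained h d)[a]|] := ltnP 0 (\dim S).
    by exists a.
  by exists 0.
have {}mP S : P S -> is_min_over (nonzero_in S) (form_quotient h d) (m S).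
  by move=> /dimP dimS; apply: mP; rewrite dimS.
exists m; split=> //.
have m_le S : P S -> m S <= lam k.
  move=> PS; have [_ m_min] := mP S PS.
  have [|X XS XJ] :=
    subspan_meets (J := [set j : 'I_n | (k <= j)%N]) (S := S) oW.
    have k_le_n : (k <= n)%N by apply: ltnW.
    by rewrite dimV dimP // card_ord_ge // addSn subnKC.
  apply: le_trans (m_min X XS) _.
  apply: (form_quotient_bounds oW dW XJ XS.2).2 => j; rewrite inE.
  exact: lam_decr.
split=> //; exists (subspan W [set j : 'I_n | (j <= k)%N]) => //.
apply/eqP; rewrite eq_le m_le //=.
have [[X [XS X_neq0] <-] _] := mP _ P_top.
apply: (form_quotient_bounds oW dW XS X_neq0).1 => j; rewrite inE.
exact: lam_decr.
Qed.

Lemma is_min_max_opp (P : {vspace V} -> Prop) (f : V -> R[i]) l :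
  is_max_min P (fun X => - f X) (- l) -> is_min_max P f l.
Proof.
case=> m [mP [[S PS mS] m_max]]; exists (fun S => - m S); split=> [T PT|].
  have [[X TX fX] m_min] := mP T PT; split=> [|Y TY].
    by exists X; rewrite // -fX opprK.
  by rewrite lerNr m_min.
split=> [|T PT]; first by exists S; rewrite // mS opprK.
by rewrite lerNr m_max.
Qed.

End CourantFischer.

(** * The algebra of the Einstein product *)

Section Tensors.
Variable R : realType.

Lemma card_midx (I : seq nat) : #|midx I| = (\prod_(d <- I) d)%N.
Proof.
elim: I => [|d I IH] /=; first by rewrite big_nil card_unit.
by rewrite big_cons card_prod card_ord IH.
Qed.

Lemma dim_tensor1 (I : seq nat) : \dim {:tensor1 R I} = (\prod_(d <- I) d)%N.
Proof. by rewrite dimvf /dim /= card_prod card_midx card_unit !muln1. Qed.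

Lemma einsteinA (I J K L : seq nat) (X : tensor R I J) (Y : tensor R J K)
    (Z : tensor R K L) : X \star (Y \star Z) = X \star Y \star Z.
Proof.
apply/ffunP=> p; rewrite !ffunE /=.
transitivity (\sum_j \sum_k
    (X (p.1, j) : R[i]) * (Y (j, k) : R[i]) * (Z (k, p.2) : R[i])).
  apply: eq_bigr => j _; rewrite ffunE mulr_sumr /=.
  by apply: eq_bigr => k _; rewrite mulrA.
rewrite exchange_big; apply: eq_bigr => k _ /=.
by rewrite ffunE mulr_suml.
Qed.

Lemma conj_transpose_einstein (I J K : seq nat) (X : tensor R I J)
    (Y : tensor R J K) :
  conj_transpose (X \star Y) = conj_transpose Y \star conj_transpose X.
Proof.
apply/ffunP=> p; rewrite !ffunE /= rmorph_sum; apply: eq_bigr => j _.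
by rewrite !ffunE /= rmorphM mulrC.
Qed.

Lemma conj_transposeK (I J : seq nat) (X : tensor R I J) :
  conj_transpose (conj_transpose X) = X.
Proof. by apply/ffunP=> -[i j]; rewrite !ffunE conjCK. Qed.

Lemma einsteinZr (I J K : seq nat) a (X : tensor R I J) (Y : tensor R J K) :
  X \star (a *: Y) = a *: (X \star Y).
Proof.
apply/ffunP=> p; rewrite !ffunE scaler_sumr; apply: eq_bigr => j _.
by rewrite ffunE; apply: mulrCA.
Qed.

Lemma einsteinDr (I J K : seq nat) (X : tensor R I J) (Y Z : tensor R J K) :
  X \star (Y + Z) = X \star Y + X \star Z.
Proof.
apply/ffunP=> p; rewrite !ffunE -big_split; apply: eq_bigr => j _.
by rewrite ffunE; apply: mulrDr.
Qed.

Lemma einsteinNr (I J K : seq nat) (X : tensor R I J) (Y : tensor R J K) :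
  X \star (- Y) = - (X \star Y).
Proof. by rewrite -scaleN1r einsteinZr scaleN1r. Qed.

Lemma einsteinNl (I J K : seq nat) (X : tensor R I J) (Y : tensor R J K) :
  (- X) \star Y = - (X \star Y).
Proof.
apply/ffunP=> p; rewrite !ffunE -sumrN; apply: eq_bigr => j _.
by rewrite ffunE; apply: mulNr.
Qed.

(** * The Hermitian forms of tensors *)

(** [X] is on the right of [A] because sesquilinear forms are linear in their
    first argument here. *)
Definition tensor_form (I : seq nat) (A : tensor R I I)
    (X Y : tensor1 R I) : R[i] :=
  scalar_of (conj_transpose Y \star A \star X).

Lemma tensor_form_hermitian (I : seq nat) (A : tensor R I I) X Y :
  hermitian_tensor A ->
  tensor_form A X Y = (-1) ^+ false * conjC (tensor_form A Y X).
Proof.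
move=> A_herm; rewrite /tensor_form mul1r -[in LHS]A_herm.
have -> : conj_transpose Y \star conj_transpose A \star X
  = conj_transpose (conj_transpose X \star A \star Y).
  by rewrite !conj_transpose_einstein conj_transposeK einsteinA.
by rewrite /scalar_of ffunE.
Qed.

Lemma tensor_form_linear (I : seq nat) (A : tensor R I I) Y :
  scalar (tensor_form A ^~ Y).
Proof.
move=> a X Z.
by rewrite /tensor_form einsteinDr einsteinZr /scalar_of !ffunE.
Qed.

Lemma tensor_form_bilinear (I : seq nat) (A : tensor R I I) :
  hermitian_tensor A ->
  bilinear_for (GRing.Scale.Law.clone _ _ *%R _)
    (GRing.Scale.Law.clone _ _ (conjC \; *%R) _) (tensor_form A).
Proof.
move=> A_herm; split=> [Y|X] a Z T /=; first exact: tensor_form_linear.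
rewrite !(tensor_form_hermitian X _ A_herm) !mul1r tensor_form_linear.
by rewrite rmorphD rmorphM.
Qed.

Lemma tensor_form_structure (I : seq nat) (A : tensor R I I) :
  hermitian_tensor A ->
  exists h : {hermitian_sym (tensor1 R I) for conjC},
    h = tensor_form A :> (_ -> _ -> _).
Proof.
move=> A_herm.
pose B := bilinear_isBilinear.Build _ _ _ _ _ _ (tensor_form A)
  (tensor_form_bilinear A_herm).
pose H := isHermitianSesquilinear.Build _ _ false conjC (tensor_form A)
  (fun X Y => tensor_form_hermitian X Y A_herm).
pose h : {hermitian_sym (tensor1 R I) for conjC} := HB.pack (tensor_form A) B H.
by exists h.
Qed.

Definition id_tensor (I : seq nat) : tensor R I I :=
  [ffun p => (p.1 == p.2)%:R].

Lemma id_tensor_hermitian (I : seq nat) : hermitian_tensor (id_tensor I).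
Proof. by apply/ffunP=> p; rewrite !ffunE /= eq_sym conjC_nat. Qed.

Lemma einstein1l (I J : seq nat) (X : tensor R I J) : id_tensor I \star X = X.
Proof.
apply/ffunP=> -[i j]; rewrite !ffunE (bigD1 i) //= big1 => [|k /negPf ki].
  by rewrite addr0 ffunE eqxx mul1r.
by rewrite ffunE eq_sym ki mul0r.
Qed.

(** The inner product is the form of the identity tensor, which makes its
    sesquilinearity an instance of that of [tensor_form]. *)
Lemma tensor_form1 (I : seq nat) (X Y : tensor1 R I) :
  tensor_form (id_tensor I) X Y = inner Y X.
Proof. by rewrite /tensor_form -einsteinA einstein1l. Qed.

Lemma inner_gt0 (I : seq nat) (X : tensor1 R I) : X != 0 -> 0 < inner X X.
Proof.
move=> X_neq0; have innerE : inner X X = \sum_j `|X (j, tt) : R[i]| ^+ 2.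
  rewrite /inner /scalar_of ffunE; apply: eq_bigr => j _.
  by rewrite ffunE normCKC.
rewrite innerE lt_def sumr_ge0 ?andbT => [|j _]; last exact: exprn_ge0.
apply: contra X_neq0 => /eqP/psumr_eq0P X0; apply/eqP/ffunP=> -[j []].
have /eqP := X0 (fun j _ => exprn_ge0 2 (normr_ge0 (X (j, tt) : R[i]))) j isT.
by rewrite sqrf_eq0 normr_eq0 ffunE => /eqP.
Qed.

Lemma inner_structure (I : seq nat) :
  exists d : {dot (tensor1 R I) for conjC}, forall X Y, d X Y = inner Y X.
Proof.
have A_herm := id_tensor_hermitian I.
have pos X : X != 0 -> 0 < tensor_form (id_tensor I) X X.
  by move=> X_neq0; rewrite tensor_form1 inner_gt0.
pose B := bilinear_isBilinear.Build _ _ _ _ _ _ (tensor_form (id_tensor I))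
  (tensor_form_bilinear A_herm).
pose H := isHermitianSesquilinear.Build _ _ false conjC
  (tensor_form (id_tensor I))
  (fun X Y => tensor_form_hermitian X Y A_herm).
pose D := isDotProduct.Build _ _ (tensor_form (id_tensor I)) pos.
pose d : {dot (tensor1 R I) for conjC} :=
  HB.pack (tensor_form (id_tensor I)) B H D.
by exists d => X Y; rewrite -tensor_form1.
Qed.

(** * The Courant-Fischer theorem for tensors *)

Lemma dim_tensor_subspan (I : seq nat) (n : nat) (U : 'I_n -> tensor1 R I) J :
  orthonormal_family U -> \dim (subspan U J) = #|J|.
Proof.
have [d dE] := inner_structure I.
by move=> oU; apply: (@dim_subspan _ _ d) => i j; rewrite dE oU eq_sym.
Qed.

Lemma tensor_max_min (I : seq nat) (n : nat) (A : tensor R I I)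
    (lam : 'I_n -> R[i]) (U : 'I_n -> tensor1 R I) (k : 'I_n)
    (P : {vspace tensor1 R I} -> Prop) :
  n = (\prod_(d <- I) d)%N -> hermitian_tensor A ->
  (forall i j : 'I_n, (i <= j)%N -> lam j <= lam i) ->
  (forall j, is_eigenpair A (lam j) (U j)) -> orthonormal_family U ->
  (forall S, P S -> \dim S = k.+1) ->
  P (subspan U [set j : 'I_n | (j <= k)%N]) ->
  is_max_min P (rayleigh A) (lam k).
Proof.
move=> n_eq A_herm lam_decr U_eigen oU dimP P_top.
have [h hE] := tensor_form_structure A_herm.
have [d dE] := inner_structure I.
have -> : rayleigh A = form_quotient h d.
  by apply/funext=> X; rewrite /form_quotient dE hE.
apply: max_min_principle lam_decr dimP P_top.
- by rewrite dim_tensor1.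
- by move=> i j; rewrite dE oU eq_sym.
move=> i j; rewrite hE /tensor_form -einsteinA U_eigen einsteinZr.
by rewrite -mulr_natr eq_sym -oU /scalar_of ffunE.
Qed.

Lemma rayleigh_opp (I : seq nat) (A : tensor R I I) X :
  rayleigh (- A) X = - rayleigh A X.
Proof. by rewrite /rayleigh einsteinNr einsteinNl /scalar_of ffunE mulNr. Qed.

(** The max-min formula for [- A] and the reversed family of eigen-tensors:
    the first [n - k] of the latter are the [U j] with [k <= j]. *)
Lemma tensor_min_max (I : seq nat) (n : nat) (A : tensor R I I)
    (lam : 'I_n -> R[i]) (U : 'I_n -> tensor1 R I) (k : 'I_n)
    (P : {vspace tensor1 R I} -> Prop) :
  n = (\prod_(d <- I) d)%N -> hermitian_tensor A ->
  (forall i j : 'I_n, (i <= j)%N -> lam j <= lam i) ->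
  (forall j, is_eigenpair A (lam j) (U j)) -> orthonormal_family U ->
  (forall S, P S -> \dim S = (n - k)%N) ->
  P (subspan U [set j : 'I_n | (k <= j)%N]) ->
  is_min_max P (rayleigh A) (lam k).
Proof.
move=> n_eq A_herm lam_decr U_eigen oU dimP P_bot.
apply: is_min_max_opp.
have -> : (fun X => - rayleigh A X) = rayleigh (- A).
  by apply/funext=> X; rewrite rayleigh_opp.
rewrite -[k in lam k]rev_ordK.
apply: (@tensor_max_min I n (- A) (fun j => - lam (rev_ord j))
  (U \o @rev_ord n)).
- by [].
- rewrite /hermitian_tensor -[in RHS]A_herm.
  by apply/ffunP=> p; rewrite !ffunE rmorphN.
- by move=> i j le_ij; rewrite lerN2 lam_decr //= leq_sub2l.
- by move=> j; rewrite /is_eigenpair einsteinNl U_eigen scaleNr.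
- by move=> i j; rewrite oU (inj_eq rev_ord_inj).
- by move=> S /dimP ->; rewrite /= subnSK.
congr P: P_bot; apply: eq_span => X.
apply/imageP/imageP => -[j]; rewrite inE => kj ->; exists (rev_ord j).
- by rewrite inE /= leq_sub2l.
- by rewrite /= rev_ordK.
- by rewrite inE -[k]rev_ordK; apply: leq_sub2l; rewrite ltnS.
- by [].
Qed.

End Tensors.

(* Eigenvalues are numbered from 0, so lam k is the (k+1)-st largest one. *)
Theorem theorem1 (R : realType) (M : nat) (I : M.-tuple nat)
    (I_pos : forall m : 'I_M, (0 < tnth I m)%N)
    (A : tensor R I I) (A_herm : hermitian_tensor A)
    (lam : 'I_(\prod_(d <- I) d)%N -> R[i])
    (U : 'I_(\prod_(d <- I) d)%N -> tensor1 R I)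
    (lam_decr : forall i j : 'I_(\prod_(d <- I) d)%N,
       (i <= j)%N -> lam j <= lam i)
    (U_eigen : forall j, is_eigenpair A (lam j) (U j))
    (U_orthonormal : orthonormal_family U)
    (k : 'I_(\prod_(d <- I) d)%N) :
  [/\ is_max_min (fun S : {vspace tensor1 R I} => \dim S = k.+1)
        (rayleigh A) (lam k),
      is_min_max (fun S : {vspace tensor1 R I} =>
          \dim S = (\prod_(d <- I) d - k)%N)
        (rayleigh A) (lam k),
      is_max_min (fun S : {vspace tensor1 R I} =>
          spanned_by U S /\ \dim S = k.+1)
        (rayleigh A) (lam k)
    & is_min_max (fun S : {vspace tensor1 R I} =>
          spanned_by U S /\ \dim S = (\prod_(d <- I) d - k)%N)
        (rayleigh A) (lam k)].
Proof.
have top : \dim (subspan U [set j : 'I__ | (j <= k)%N]) = k.+1.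
  by rewrite dim_tensor_subspan //; apply: (card_ord_lt (ltn_ord k)).
have bot : \dim (subspan U [set j : 'I__ | (k <= j)%N])
    = (\prod_(d <- I) d - k)%N.
  by rewrite dim_tensor_subspan // card_ord_ge // ltnW.
have spanned J : spanned_by U (subspan U J) by exists J.
split.
- exact: tensor_max_min U_orthonormal _ top.
- exact: tensor_min_max U_orthonormal _ bot.
- apply: tensor_max_min U_orthonormal _ (conj (spanned _) top) => //.
  by move=> S [].
- apply: tensor_min_max U_orthonormal _ (conj (spanned _) bot) => //.
  by move=> S [].
Qed.
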